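(* Let $n\geq 2$ and $m, A_1, A_2,\dots,A_n$ be positive integers, and let $R=A_1+\cdots+A_n+m$. For $1\leq i\leq m$ and real numbers $x_1,\dots,x_n$ define $$f_i(x_1,\dots,x_n)=\left\lfloor \operatorname{mod}\left(\left\lfloor\frac{x_n}{R}\right\rfloor 2^{-R^n\lfloor x_1\rfloor-R^{n-1}\lfloor x_2\rfloor-\cdots-R^2\lfloor x_{n-1}\rfloor-R\operatorname{mod}(\lfloor x_n\rfloor,R)-i},\,2\right)\right\rfloor .$$ Then for any $m$ pairwise disjoint subsets $S_1,\dots,S_m$ of $S=\big([0,A_1)\times\cdots\times[0,A_n)\big)\cap\mathbb{Z}^n$, the natural number (nonnegative integer) $$k=R\sum_{j=1}^{m}\ \sum_{(m_1,\dots,m_n)\in S_j}2^{R^n m_1+R^{n-1}m_2+\cdots+R m_n+j}$$ satisfies, for all $1\leq i\leq m$, $$\left\{(x_1,\dots,x_n)\in\mathbb{R}^n:\ \tfrac12<f_i(x_1,\dots,x_n)\ \text{ and }\ (x_1,\dots,x_{n-1},x_n-k)\in[0,A_1)\times\cdots\times[0,A_n)\right\}$$ $$=\left\{(x_1,\dots,x_n)\in\mathbb{R}^n:\ (\lfloor x_1\rfloor,\lfloor x_2\rfloor,\dots,\lfloor x_{n-1}\rfloor,\lfloor x_n-k\rfloor)\in S_i\right\}.$$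
   Context: $\lfloor\cdot\rfloor$ is the floor function. For a real number $a$ and a positive integer $b$, $\operatorname{mod}(a,b)=a-b\lfloor a/b\rfloor\in[0,b)$ is the real remainder of $a$ modulo $b$. Intervals $[0,A_j)$ are half-open intervals of real numbers. In the exponent defining $k$, the coefficient of $m_l$ is $R^{n+1-l}$ for $1\le l\le n$; in the exponent defining $f_i$, the coefficient of $\lfloor x_l\rfloor$ is $-R^{n+1-l}$ for $1\le l\le n-1$, and the coefficient of $\operatorname{mod}(\lfloor x_n\rfloor,R)$ is $-R$. Empty sums equal $0$. *)

(* Defs.v *)
From mathcomp Require Import all_boot all_order all_algebra.
From mathcomp Require Import all_classical all_reals all_analysis.

Set Implicit Arguments.
Unset Strict Implicit.
Unset Printing Implicit Defensive.

Import Order.TTheory GRing.Theory Num.Theory.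

Local Open Scope classical_set_scope.
Local Open Scope ring_scope.

(* Coordinates are numbered from 0: the mathematical coordinate x_l
   (1 <= l <= n) is x ord0 i with i : 'I_n of value l - 1, so the coefficient
   R ^ (n + 1 - l) is R ^ (n - i). *)

Definition last_ord (n : nat) (hn : (2 <= n)%N) : 'I_n :=
  Ordinal (etrans (ltn_predL n) (ltnW hn)).

Definition radix (n : nat) (A : 'I_n -> nat) (m : nat) : nat :=
  (\sum_(l < n) A l + m)%N.

Definition rmod (K : realType) (a : K) (b : nat) : K :=
  a - b%:R * (Num.floor (a / b%:R))%:~R.

Definition box (K : realType) (n : nat) (A : 'I_n -> nat) : set 'rV[K]_n :=
  [set x | forall l : 'I_n, x ord0 l \in `[0, (A l)%:R[ ].

Definition lattice_box (K : realType) (n : nat) (A : 'I_n -> nat) :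
    set 'rV[int]_n :=
  [set p | box A (map_mx (intr : int -> K) p)].

(* The real exponent of 2 is an integer; [powR] is used because [rmod] is
   real-valued. *)
Definition bit_fun (K : realType) (n : nat) (hn : (2 <= n)%N)
    (A : 'I_n -> nat) (m i : nat) (x : 'rV[K]_n) : int :=
  let R := radix A m in
  let xn := x ord0 (last_ord hn) in
  Num.floor (rmod
    ((Num.floor (xn / R%:R))%:~R *
     (2 : K) `^ (- (\sum_(l < n | (l.+1 < n)%N)
                 (R ^ (n - l))%N%:R * (Num.floor (x ord0 l))%:~R)
           - R%:R * rmod (Num.floor xn)%:~R R
           - i%:R)) 2%N).

(* S j is the set with mathematical index j + 1.  The inner sum ranges over a
   classical set; it is the usual finite sum when S j is finite, in
   particular when S j is contained in [lattice_box A]. *)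
Definition code_number (K : realType) (n : nat) (A : 'I_n -> nat) (m : nat)
    (S : 'I_m -> set 'rV[int]_n) : K :=
  let R := radix A m in
  R%:R * \sum_(j < m) \sum_(p \in S j)
    (2 : K) `^ (\sum_(l < n) (R ^ (n - l))%N%:R * (p ord0 l)%:~R + j.+1%:R).

Definition shift_last (K : realType) (n : nat) (hn : (2 <= n)%N) (k : K)
    (x : 'rV[K]_n) : 'rV[K]_n :=
  x - k *: delta_mx ord0 (last_ord hn).

(* Main.v *)
(* k is R times a number N whose binary digits are indexed by the integers
   R^n m_1 + ... + R m_n + j.  Every m_l and every j lies in [0, R), so
   (m_1, ..., m_n, j) are base-R digits: these exponents are pairwise distinct,
   and the bit of N at the exponent coded by (p, i) is 1 exactly when p is in S_i.
   If x - k e_n is in the box, then floor (x_n / R) = N and floor x_n is congruent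
   to floor (x_n - k) modulo R, so f_i (x) is the bit of N at the exponent coded by
   the floors of x - k e_n and i. *)
Require Import Defs.
From mathcomp Require Import all_boot all_order all_algebra.
From mathcomp Require Import finmap.
From mathcomp Require Import all_classical all_reals all_analysis.

Set Implicit Arguments.
Unset Strict Implicit.
Unset Printing Implicit Defensive.

Import Order.TTheory GRing.Theory Num.Theory.

Local Open Scope classical_set_scope.
Local Open Scope ring_scope.

(** When all entries are below [R], this is the number with base-[R] digits [d 0], [d 1], ... from
    the most significant down, and [c] in the units place. *)
Definition digit_code (R n : nat) (d : 'I_n -> nat) (c : nat) : nat :=
  (\sum_(l < n) R ^ (n - l) * d l + c)%N.

(** Horner's rule: division by [R] strips off the units digit and the last [d] takes its place,
    which drives the induction in [digit_code_inj]. *)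
Lemma digit_codeS (R n : nat) (d : 'I_n.+1 -> nat) (c : nat) :
  digit_code R d c =
  (digit_code R (d \o widen_ord (leqnSn n)) (d ord_max) * R + c)%N.
Proof.
rewrite /digit_code big_ord_recr /= subSnn expn1 mulnDl big_distrl /=.
congr (_ + _ + _)%N; last exact: mulnC.
by apply: eq_bigr => l _; rewrite subSn 1?ltnW// expnSr mulnAC.
Qed.

Lemma digit_code_inj (R n : nat) (d d' : 'I_n -> nat) (c c' : nat) :
  (forall l, d l < R)%N -> (forall l, d' l < R)%N -> (c < R)%N -> (c' < R)%N ->
  digit_code R d c = digit_code R d' c' -> d =1 d' /\ c = c'.
Proof.
elim: n d d' c c' => [|n IHn] d d' c c' dR d'R cR c'R.
  by rewrite /digit_code !big_ord0 !add0n => ->; split => // -[].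
have R0 : (0 < R)%N by apply: leq_ltn_trans cR.
rewrite !digit_codeS => E.
have := congr1 (divn^~ R) E; have := congr1 (modn^~ R) E.
rewrite /= !modnMDl !modn_small// => cc'.
rewrite !divnMDl// !divn_small// !addn0.
case/IHn => // [l|l|dd' dm]; [exact: dR|exact: d'R|].
split=> // l; have [j ->|->//] := unliftP ord_max l.
suff -> : lift ord_max j = widen_ord (leqnSn n) j by exact: dd'.
by apply: val_inj; rewrite /= /bump leqNgt ltn_ord.
Qed.

(** Induction on [b]: all terms after the first make up twice the sum for the shifted digits, so
    [d 0] is the parity and one halving lowers [e] by one. *)
Lemma odd_digits_divn_exp2 (d : nat -> bool) (b e : nat) :
  odd ((\sum_(a < b) d a * 2 ^ a) %/ 2 ^ e) = (e < b)%N && d e.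
Proof.
elim: b d e => [|b IHb] d e; first by rewrite big_ord0 div0n.
rewrite big_ord_recl /= expn0 muln1.
under eq_bigr => a _ do rewrite /bump /= add1n expnS mulnCA.
rewrite -big_distrr /= addnC mulnC.
case: e => [|e].
  by rewrite expn0 divn1 oddD oddM andbF /=; case: (d 0%N).
rewrite expnS divnMA divnMDl// (divn_small (m := d 0%N)) ?addn0;
  last by case: (d 0%N).
exact: (IHb (fun a => d a.+1)).
Qed.

(** Distinct exponents cause no carries, so the sum is a binary expansion whose digits record
    membership in [s]. *)
Lemma odd_sum_exp2_divn (s : seq nat) (e : nat) :
  uniq s -> odd ((\sum_(a <- s) 2 ^ a) %/ 2 ^ e) = (e \in s).
Proof.
move=> us; pose b := (\max_(a <- s) a).+1.
have sb a : a \in s -> (a < b)%N by move=> sa; rewrite ltnS (big_rem a)//= leq_maxl.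
have -> : (\sum_(a <- s) 2 ^ a = \sum_(a < b) ((a : nat) \in s) * 2 ^ a)%N.
  rewrite (perm_big [seq a <- index_iota 0 b | a \in s]); last first.
    apply: uniq_perm => //; first by rewrite filter_uniq ?iota_uniq.
    move=> a; rewrite mem_filter mem_index_iota.
    by case: (boolP (a \in s)) => // /sb ->.
  rewrite big_filter big_mkcond big_mkord.
  by apply: eq_bigr => a _; case: (_ \in _); rewrite ?mul1n ?mul0n.
rewrite (odd_digits_divn_exp2 (fun a => a \in s)).
by case: (boolP (e \in s)) => [/sb ->//|]; rewrite andbF.
Qed.

Lemma floor_natr_div (K : realType) (a b : nat) :
  (0 < b)%N -> Num.floor (a%:R / b%:R : K) = (a %/ b)%:Z.
Proof.
move=> b0; apply: floor_def.
rewrite ler_pdivlMr ?ltr_pdivrMr ?ltr0n// intrD mulr1z -!pmulrn natr1.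
by rewrite -!natrM ler_nat ltr_nat leq_trunc_div ltn_ceil.
Qed.

Lemma rmod_nat (K : realType) (a b : nat) :
  (0 < b)%N -> rmod (a%:R : K) b = (a %% b)%:R.
Proof.
move=> b0; rewrite /rmod floor_natr_div// -pmulrn [in X in X - _](divn_eq a b).
by rewrite natrD natrM [X in _ - X]mulrC addrAC subrr add0r.
Qed.

(** With [q] for [a %/ 2 ^ e], the real remainder subtracts the integer [2 * (q %/ 2)], which comes
    out of the floor and leaves [q %% 2]. *)
Lemma floor_rmod_natr_div_exp2 (K : realType) (a e : nat) :
  Num.floor (rmod (a%:R / (2 ^ e)%:R : K) 2) = Posz (odd (a %/ 2 ^ e)).
Proof.
rewrite /rmod -mulrA -invfM -natrM floor_natr_div ?muln_gt0 ?expn_gt0//.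
rewrite -pmulrn -natrM [X in _ - X]pmulrn -mulrNz.
rewrite floorDrz ?intr_int// intrKfloor floor_natr_div ?expn_gt0// -expnSr expnSr divnMA.
rewrite [in X in X + _](divn_eq (a %/ 2 ^ e) 2) modn2 PoszD mulnC.
by rewrite addrAC subrr add0r.
Qed.

Lemma lattice_boxP (K : realType) (n : nat) (A : 'I_n -> nat) (p : 'rV[int]_n) :
  lattice_box K A p <->
  exists2 d : 'I_n -> nat, (forall l, d l < A l)%N & p = \row_l (d l)%:Z.
Proof.
split=> [pA|[d dA ->] l]; last first.
  by rewrite !mxE in_itv /= -pmulrn ler0n ltr_nat dA.
have pE l : p ord0 l = `|p ord0 l|%N%:Z.
  by have := pA l; rewrite mxE in_itv /= ler0z => /andP[p0 _]; rewrite gez0_abs.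
exists (fun l => `|p ord0 l|%N) => [l|].
  by have := pA l; rewrite mxE in_itv /= pE -pmulrn ltr_nat => /andP[].
by apply/rowP => l; rewrite mxE -pE.
Qed.

(** Makes every [S j] finite, so that the sum in [code_number] is a genuine finite sum and
    [fset_set (S j)] has the same elements as [S j]. *)
Lemma finite_lattice_box (K : realType) (n : nat) (A : 'I_n -> nat) :
  finite_set (lattice_box K A).
Proof.
pose B := \max_l A l.
pose F (f : {ffun 'I_n -> 'I_B}) : 'rV[int]_n := \row_l (f l : nat)%:Z.
apply: (@sub_finite_set _ _ (F @` setT)); last exact/finite_image/finite_finset.
move=> p /lattice_boxP[d dA ->].
have dB l : (d l < B)%N by apply: leq_trans (dA l) (leq_bigmax l).
exists [ffun l => Ordinal (dB l)] => //.
by apply/rowP => l; rewrite !mxE ffunE.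
Qed.

(** The bounds [0] and [A l] are integers, so a real number lies between them exactly when its floor
    does. *)
Lemma box_floor (K : realType) (n : nat) (A : 'I_n -> nat) (y : 'rV[K]_n) :
  box A y <-> lattice_box K A (map_mx Num.floor y).
Proof.
by split=> yA l; have := yA l;
  rewrite !mxE !in_itv /= ler0z floor_ge0 pmulrn ltr_int floor_lt_int.
Qed.

(** Here [d] holds the floors of the point before its last coordinate is shifted by [N * R]. *)
Lemma bit_fun_digit_code (K : realType) (n : nat) (hn : (2 <= n)%N)
    (A : 'I_n -> nat) (m i N : nat) (d : 'I_n -> nat) (x : 'rV[K]_n) :
  (d (last_ord hn) < radix A m)%N ->
  (forall l, Num.floor (x ord0 l) =
     ((l == last_ord hn) * (N * radix A m) + d l)%N%:Z) ->
  bit_fun hn A m i x = Posz (odd (N %/ 2 ^ digit_code (radix A m) d i)).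
Proof.
rewrite /bit_fun; set R := radix A m; set z := last_ord hn => dR xE.
have R0 : (0 < R)%N by apply: leq_ltn_trans dR.
have xz := xE z; rewrite eqxx mul1n in xz.
have -> : Num.floor (x ord0 z / R%:R) = N%:Z.
  apply: floor_def; rewrite ler_pdivlMr ?ltr_pdivrMr ?ltr0n//.
  rewrite intrD mulr1z -!pmulrn natr1 -!natrM.
  have /andP[lo up] := floor_itv (x ord0 z).
  rewrite (le_trans _ lo) ?xz -?pmulrn ?ler_nat ?leq_addr//=.
  apply: lt_le_trans up _; rewrite xz intrD mulr1z -pmulrn natr1 ler_nat.
  by rewrite mulSn addnC -addSn leq_add2r.
rewrite xz -!pmulrn rmod_nat// modnMDl modn_small//.
rewrite -opprD -opprD powRN.
rewrite (_ : _ + i%:R = (digit_code R d i)%:R); last first.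
  rewrite /digit_code natrD natr_sum; congr (_ + i%:R).
  rewrite [RHS](bigD1 z)//= addrC natrM; congr (_ + _ * _); last first.
    (* Coordinates count from 0, so the last one has weight [R ^ (n - n.-1)], the factor [R] written
       explicitly in [bit_fun]. *)
    rewrite (_ : n - n.-1 = 1)%N ?expn1//.
    by rewrite -[X in (X - _)%N](ltn_predK hn) subSnn.
  apply: eq_big => [l|l lz].
    rewrite -val_eqE /= -[X in (_ < X)%N](ltn_predK hn) ltnS ltn_neqAle.
    by rewrite -ltnS (ltn_predK hn) ltn_ord andbT.
  rewrite natrM xE (_ : (l == z) = false) -?pmulrn//.
  by apply/eqP => lE; move: lz; rewrite lE /= (ltn_predK hn) ltnn.
by rewrite powR_mulrn// -natrX floor_rmod_natr_div_exp2.
Qed.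

(** Absolute values only turn integers into naturals: lattice points of the box have nonnegative
    coordinates. *)
Definition code_exponents (n : nat) (A : 'I_n -> nat) (m : nat)
    (S : 'I_m -> set 'rV[int]_n) : seq nat :=
  [seq digit_code (radix A m) (fun l => `|p ord0 l|%N) j.+1
  | j : 'I_m <- enum 'I_m, p : 'rV[int]_n <- fset_set (S j)].

Section code_exponents.
Context (K : realType) (n : nat) (A : 'I_n -> nat) (m : nat).
Context (S : 'I_m -> set 'rV[int]_n).
Context (SA : forall j, S j `<=` lattice_box K A).
Context (A0 : forall l, (0 < A l)%N) (n0 : (0 < n)%N).

Let R := radix A m.

Let finS j : finite_set (S j).
Proof. exact: sub_finite_set (@SA j) (finite_lattice_box K A). Qed.

Let A_le_radix l : (A l <= R)%N.
Proof. by rewrite /R /radix (bigD1 l)//= -addnA leq_addr. Qed.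

Let mem_fset_set j p : (p \in (fset_set (S j) : seq _)) -> S j p.
Proof. by move=> ?; apply/set_mem; rewrite -in_fset_set. Qed.

Let code_inj (j j' : 'I_m) (p p' : 'rV[int]_n) :
  S j p -> lattice_box K A p' ->
  digit_code R (fun l => `|p ord0 l|%N) j.+1 =
  digit_code R (fun l => `|p' ord0 l|%N) j'.+1 -> j = j' /\ p = p'.
Proof.
move=> /SA/lattice_boxP[d dA ->] /lattice_boxP[d' d'A ->].
(* The units digit [i.+1] can reach [m]; it stays below [R] because some [A l] is positive. *)
have jR (i : 'I_m) : (i.+1 < R)%N.
  rewrite (@leq_ltn_trans m)// /R /radix -[X in (X < _)%N]add0n ltn_add2r.
  by rewrite (bigD1 (Ordinal n0))//= addn_gt0 A0.
case/digit_code_inj => // [l|l|dd' [/val_inj ->]]; rewrite ?mxE.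
- by apply: leq_trans (dA l) _.
- by apply: leq_trans (d'A l) _.
split=> //; apply/rowP => l; rewrite !mxE; congr Posz.
by have := dd' l; rewrite !mxE.
Qed.

Lemma uniq_code_exponents : uniq (code_exponents A S).
Proof.
apply: allpairs_uniq_dep => [|j _|];
  rewrite ?enum_uniq ?fset_uniq//.
move=> u v /allpairsPdep[j [p [_ /mem_fset_set Sp ->]]].
move=> /allpairsPdep[j' [p' [_ /mem_fset_set Sp' ->]]] /=.
by case/(code_inj Sp (@SA j' _ Sp')) => -> ->.
Qed.

Lemma mem_code_exponents (i : 'I_m) (p : 'rV[int]_n) :
  lattice_box K A p ->
  digit_code R (fun l => `|p ord0 l|%N) i.+1 \in code_exponents A S <-> S i p.
Proof.
move=> pA; split=> [/allpairsPdep[j [q [_ /mem_fset_set Sq]]]|Sp].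
  by move/esym/(code_inj Sq pA) => [<- <-].
apply/allpairsPdep; exists i, p; split=> //; first exact: mem_enum.
by rewrite in_fset_set// inE.
Qed.

(** Brings [k] into the natural numbers, where its quotient by [R] is the sum whose bits are
    read. *)
Lemma code_numberE :
  code_number K A S = (\sum_(e <- code_exponents A S) 2 ^ e * R)%N%:R.
Proof.
rewrite /code_number -/R -big_distrl /= mulnC natrM; congr (_ * _).
rewrite /code_exponents big_allpairs_dep /= natr_sum big_enum /=.
apply: eq_bigr => j _; rewrite fsbig_finite//= natr_sum.
rewrite !big_seq; apply: eq_bigr => p /mem_fset_set /SA/lattice_boxP[d _ ->].
rewrite natrX -powR_mulrn//; congr (_ `^ _); rewrite /digit_code natrD natr_sum.
by congr (_ + _); apply: eq_bigr => l _; rewrite mxE natrM.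
Qed.

End code_exponents.

Theorem theorem1 (K : realType) (n : nat) (hn : (2 <= n)%N)
    (m : nat) (hm : (0 < m)%N)
    (A : 'I_n -> nat) (hA : forall l : 'I_n, (0 < A l)%N)
    (S : 'I_m -> set 'rV[int]_n)
    (hS : forall j : 'I_m, S j `<=` lattice_box K A)
    (hdisj : trivIset setT S) :
  let k : K := code_number K A S in
  k \is a Num.nat /\
  forall i : 'I_m,
    [set x : 'rV[K]_n | 1 / 2 < (bit_fun hn A m i.+1 x)%:~R :> K /\
                        box A (shift_last hn k x)]
    = [set x : 'rV[K]_n | S i (map_mx Num.floor (shift_last hn k x))].
Proof.
move=> k; pose N := (\sum_(e <- code_exponents A S) 2 ^ e)%N.
have n0 : (0 < n)%N by exact: ltnW.
have kE : k = (N * radix A m)%N%:R by rewrite /k (code_numberE hS) big_distrl.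
split=> [|i]; first by rewrite kE natr_nat.
(* On both sides the shifted point lies in the box, on the right because [S i] is contained in
   [lattice_box K A]; it suffices to compare the conditions there. *)
have bitE x : box A (shift_last hn k x) ->
    1 / 2 < (bit_fun hn A m i.+1 x)%:~R :> K <->
    S i (map_mx Num.floor (shift_last hn k x)).
  move=> /box_floor yA; rewrite -(mem_code_exponents hS hA n0 i yA).
  have [d dA yE] := (lattice_boxP _ _ _).1 yA.
  rewrite (@bit_fun_digit_code _ _ _ _ _ _ N d); first last.
  (* The shift [k] is an integer and comes out of the floor. *)
  - move=> l; have := congr1 (fun p : 'rV_n => p ord0 l) yE.
    rewrite /shift_last !mxE eqxx /= kE -natrM [X in _ - X]pmulrn -mulrNz.
    rewrite floorDrz ?intr_int// intrKfloor => /eqP.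
    by rewrite subr_eq => /eqP ->; rewrite -PoszD addnC [in RHS]mulnC.
  - apply: leq_trans (dA _) _.
    by rewrite /radix (bigD1 (last_ord hn))//= -addnA leq_addr.
  rewrite odd_sum_exp2_divn ?(uniq_code_exponents hS hA n0)// yE.
  rewrite (_ : (fun l => _) = d); last by apply/funext => l; rewrite mxE.
  (* The bit is 0 or 1, so it exceeds one half exactly when it is 1. *)
  by case: (_ \in _) => /=; split=> //;
    rewrite ?mulr0z ltr_pdivrMr// ?mul1r ?mul0r ?ltr1n ?ltr10.
apply/seteqP; split=> x /=; first by case=> bx xA; apply/(bitE _ xA).
move=> Sx; have xA : box A (shift_last hn k x) by apply/box_floor; apply: (@hS i).
by split=> //; apply/(bitE _ xA).
Qed.
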